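(* For all $(a,b)\in\mathbb{C}^2\setminus\{(0,0)\}$ and $(X,T)\in\mathbb{R}^2$, $$\Psi(X,T;\mathbf{G}(a,b))=\Psi(-X,T;\mathbf{G}(b,a)).$$
   Context: Notation: $*$ is complex conjugation; $\sigma_3=\mathrm{diag}(1,-1)$; $\mathrm{e}^{f\sigma_3}=\mathrm{diag}(\mathrm{e}^{f},\mathrm{e}^{-f})$. For $(a,b)\in\mathbb{C}^2\setminus\{(0,0)\}$ let $$\mathbf{G}(a,b)=\frac{1}{\sqrt{|a|^2+|b|^2}}\begin{bmatrix}a & b^*\\ -b & a^*\end{bmatrix}.$$ For $(X,T)\in\mathbb{R}^2$ and $\mathbf{G}=\mathbf{G}(a,b)$, $\mathbf{P}(\Lambda;X,T,\mathbf{G})$ denotes the unique (it is known to exist) $2\times 2$ matrix function of $\Lambda$ such that: (i) it is analytic for $|\Lambda|\neq 1$ and takes continuous boundary values on the unit circle from the interior and from the exterior; (ii) writing $\mathbf{P}_+$ (resp. $\mathbf{P}_-$) for the boundary value on $|\Lambda|=1$ from the exterior (resp. interior), $$\mathbf{P}_+=\mathbf{P}_-\,\mathrm{e}^{-\mathrm{i}(\Lambda X+\Lambda^2T+2\Lambda^{-1})\sigma_3}\,\mathbf{G}\,\mathrm{e}^{\mathrm{i}(\Lambda X+\Lambda^2T+2\Lambda^{-1})\sigma_3},\quad |\Lambda|=1;$$ (iii) $\mathbf{P}\to\mathbb{I}$ as $\Lambda\to\infty$. Then $\Psi(X,T;\mathbf{G}):=2\mathrm{i}\lim_{\Lambda\to\infty}\Lambda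 P_{12}(\Lambda;X,T,\mathbf{G})$. *)

(* Defs.v *)
From HB Require Import structures.
From mathcomp Require Import all_boot all_order all_algebra.
From mathcomp Require Import complex.
From mathcomp Require Import all_classical all_reals all_analysis.

Set Implicit Arguments.
Unset Strict Implicit.
Unset Printing Implicit Defensive.

Import Order.TTheory GRing.Theory Num.Theory.
Import numFieldNormedType.Exports.

Local Open Scope classical_set_scope.
Local Open Scope ring_scope.
Local Open Scope complex_scope.

(* The complex numbers are [R[i]].  The library puts the topology and the
   normed-module structure on the alias [R[i]^o], so limits and derivatives are
   stated there; [derivable f z 1] over [R[i]^o] is complex
   differentiability.  The norm [`|z|] takes its values in [R[i]]. *)

Definition mx2 (R : realType) (a b c d : R[i]) : 'M[R[i]]_2 :=
  \matrix_(i < 2, j < 2)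
    (if i == 0 then (if j == 0 then a else b)
     else (if j == 0 then c else d)).

Definition cexp (R : realType) (z : R[i]) : R[i] :=
  (expR (complex.Re z))%:C * (cos (complex.Im z) +i* sin (complex.Im z)).

Definition exp_sigma3 (R : realType) (f : R[i]) : 'M[R[i]]_2 :=
  mx2 (cexp f) 0 0 (cexp (- f)).

Definition Gmx (R : realType) (a b : R[i]) : 'M[R[i]]_2 :=
  (sqrtC (`|a| ^+ 2 + `|b| ^+ 2))^-1 *: mx2 a (b^*)%C (- b) (a^*)%C.

Definition phase (R : realType) (X T : R) (z : R[i]) : R[i] :=
  z * X%:C + z ^+ 2 * T%:C + 2 * z^-1.

Definition jump (R : realType) (X T : R) (G : 'M[R[i]]_2) (z : R[i]) :
    'M[R[i]]_2 :=
  exp_sigma3 (- ('i%C * phase X T z)) *m G *m exp_sigma3 ('i%C * phase X T z).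

Definition circle (R : realType) : set R[i]^o := [set z | `|z| = 1].
Definition interior_disc (R : realType) : set R[i]^o := [set z | `|z| < 1].
Definition exterior_disc (R : realType) : set R[i]^o := [set z | 1 < `|z|].

Definition cinfty (R : realType) : set_system R[i]^o :=
  [set A | exists M : R, forall z : R[i]^o, M%:C < `|z| -> A z].

Definition analytic_off_circle (R : realType) (P : R[i] -> 'M[R[i]]_2) :=
  forall i j (z : R[i]^o), ~ circle z ->
    derivable (fun w : R[i]^o => P w i j : R[i]^o) z 1.

Definition has_boundary_value (R : realType) (D : set R[i]^o)
    (P Pb : R[i] -> 'M[R[i]]_2) :=
  forall i j,
    (forall z : R[i]^o, circle z ->
       (fun w : R[i]^o => P w i j : R[i]^o) @ within D (nbhs z)
         --> (Pb z i j : R[i]^o)) /\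
    {within @circle R, continuous (fun z : R[i]^o => Pb z i j : R[i]^o)}.

(* [P] lives on the complement of the unit circle; as a total function its
   values on the circle are irrelevant. *)
Definition RHP_solution (R : realType) (X T : R) (G : 'M[R[i]]_2)
    (P : R[i] -> 'M[R[i]]_2) :=
  [/\ analytic_off_circle P,
      exists Pplus Pminus : R[i] -> 'M[R[i]]_2,
        [/\ has_boundary_value (@exterior_disc R) P Pplus,
            has_boundary_value (@interior_disc R) P Pminus &
            forall z : R[i]^o, circle z ->
              Pplus z = Pminus z *m jump X T G z] &
      forall i j, (fun z : R[i]^o => P z i j : R[i]^o) @ @cinfty R
        --> ((1%:M : 'M[R[i]]_2) i j : R[i]^o)].

Definition RHP_unique_solution (R : realType) (X T : R) (G : 'M[R[i]]_2)
    (P : R[i] -> 'M[R[i]]_2) :=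
  RHP_solution X T G P /\
  forall Q, RHP_solution X T G Q ->
    forall z : R[i]^o, ~ circle z -> Q z = P z.

(* Definite description: the unique solution of the Riemann-Hilbert problem;
   the value [1%:M] is only a default. *)
Definition Pmx (R : realType) (X T : R) (G : 'M[R[i]]_2) :
    R[i] -> 'M[R[i]]_2 :=
  xget (fun=> 1%:M) [set P | RHP_unique_solution X T G P].

Definition Psi (R : realType) (X T : R) (G : 'M[R[i]]_2) : R[i] :=
  2 * 'i%C * lim ((fun z : R[i]^o => z * Pmx X T G z 0 1 : R[i]^o) @ @cinfty R).

(* Main.v *)
(* Since G(b,a) = - sigma1 G(a,b) sigma3 and conjugation by sigma1 inverts
   exp(f sigma3), the substitution z -> -z turns the jump matrix of
   (X, T, G(a,b)) into that of (-X, T, G(b,a)), up to a left factor analytic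
   inside the disc and a right factor analytic outside.  The sign of the pole
   2/z of the phase is the only obstruction: it is absorbed by exp(4i/z sigma3),
   analytic outside, while the polynomial part of the phase is absorbed inside.
   The resulting map P -> sigma3 P(-z) E(z) on solutions is an involution, and
   the outer factor tends to sigma3 at infinity, so it preserves the limit of
   z P12(z). *)
Require Import Defs.
From mathcomp Require Import all_boot all_order all_algebra.
From mathcomp Require Import complex.
From mathcomp Require Import all_classical all_reals all_analysis.
From mathcomp Require Import ring lra.

Set Implicit Arguments.
Unset Strict Implicit.
Unset Printing Implicit Defensive.

Import Order.TTheory GRing.Theory Num.Theory.
Import numFieldNormedType.Exports.

Local Open Scope classical_set_scope.
Local Open Scope ring_scope.
Local Open Scope complex_scope.

(** * Complex differentiability of the exponential *)

Lemma is_derive0_le (R : realType) (f : R -> R) (df e : R) :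
  is_derive (0 : R) 1 f df -> 0 < e ->
  exists2 d, 0 < d & forall h, `|h| < d -> `|f h - f 0 - h * df| <= e * `|h|.
Proof.
move=> [dvf <-] e0.
have /cvgrPdist_le/(_ _ e0) := dvf.
rewrite -/(derive f 0 1) => /nbhs_normP[d d0 dP].
exists d => // h hd; have [->|h0] := eqVneq h 0.
  by rewrite subrr mul0r subr0 normr0 mulr0.
have := dP h; rewrite /= sub0r normrN addr0 [_ *: 1]mulr1 => /(_ hd h0).
have -> : f h - f 0 - h * 'D_1 f 0 = - h * ('D_1 f 0 - h^-1 *: (f h - f 0)).
  by rewrite /GRing.scale/=; field.
by rewrite normrM normrN mulrC => /ler_wpM2r; apply.
Qed.

Lemma cexpD (R : realType) (z w : R[i]) : cexp (z + w) = cexp z * cexp w.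
Proof.
case: z w => [a b] [c d]; rewrite /cexp /= expRD cosD sinD.
by apply/eqP; rewrite eq_complex /=; apply/andP; split; apply/eqP; ring.
Qed.

Lemma cexp0 (R : realType) : cexp (0 : R[i]) = 1.
Proof.
rewrite /cexp /= expR0 cos0 sin0.
by apply/eqP; rewrite eq_complex /=; apply/andP; split; apply/eqP; ring.
Qed.

Lemma pos_complex_real (R : realType) (e : R[i]) :
  0 < e -> exists2 r : R, 0 < r & e = r%:C.
Proof.
by case: e => x y; rewrite ltcE /= => /andP[/eqP -> x0]; exists x.
Qed.

Lemma normc_le_ReIm (R : realType) (z : R[i]) :
  `|z| <= (`|complex.Re z| + `|complex.Im z|)%:C.
Proof.
rewrite normc_def lecR -[leRHS]ger0_norm ?addr_ge0 // -sqrtr_sqr ler_wsqrtr //.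
by rewrite sqrrD !real_normK ?num_real // lerD2r lerDl mulrn_wge0 // mulr_ge0.
Qed.

Lemma normc_Re_Im_le (R : realType) (z : R[i]) (d : R) :
  `|z| < d%:C -> `|complex.Re z| < d /\ `|complex.Im z| < d.
Proof.
rewrite normc_def ltcR => zd.
by split; apply: le_lt_trans zd; rewrite -sqrtr_sqr ler_wsqrtr
  ?lerDl ?lerDr ?sqr_ge0.
Qed.

Lemma normc_ge_Re_Im (R : realType) (z : R[i]) :
  (`|complex.Re z|%:C <= `|z|) /\ (`|complex.Im z|%:C <= `|z|).
Proof.
by rewrite normc_def !lecR;
  split; rewrite -sqrtr_sqr ler_wsqrtr ?lerDl ?lerDr ?sqr_ge0.
Qed.

(** Real and imaginary parts are estimated separately, from the first-order expansions at 0 of the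
    real [expR], [cos] and [sin]. *)
Lemma cexp_taylor1 (R : realType) (e : R) : 0 < e ->
  exists2 d, 0 < d & forall h : R[i], `|h| < d%:C ->
    `|cexp h - 1 - h| <= e%:C * `|h|.
Proof.
(* The errors of the two parts add up to at most 8 e' (|x| + |y|), and |x| + |y| <= 2 |h|, whence
   the 16. The bound e' <= 1 yields the factors 2 in [S1], [X1] and [B1]. *)
move=> e0; have [e' [e'0 e'1 e'8]] :
    exists e' : R, [/\ 0 < e', e' <= 1 & e' * 16 <= e].
  exists (Num.min 1 (e / 16)); split; first by rewrite lt_min ltr01 divr_gt0.
    by rewrite ge_min lexx.
  by rewrite -ler_pdivlMr // ge_min lexx orbT.
have [d1 d10 d1P] := is_derive0_le (is_derive_expR 0) e'0.
have [d2 d20 d2P] := is_derive0_le (is_derive_cos 0) e'0.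
have [d3 d30 d3P] := is_derive0_le (is_derive_sin 0) e'0.
exists (Num.min (Num.min e' d1) (Num.min d2 d3)) => [|h hd].
  by rewrite !lt_min e'0 d10 d20 d30.
have [] := normc_Re_Im_le hd; rewrite !lt_min.
move=> /andP[/andP[xe x1] _] /andP[/andP[ye _] /andP[y2 y3]].
have [hx hy] := normc_ge_Re_Im h.
have [m mE] : exists m : R, `|h| = m%:C by rewrite normc_def; eexists.
move: hx hy; rewrite mE -rmorphM ![_ <= m%:C]lecR => hx hy.
apply: le_trans (normc_le_ReIm _) _; rewrite lecR.
apply: (@le_trans _ _ (8 * e' * (`|complex.Re h| + `|complex.Im h|))); last first.
  have := normr_ge0 (complex.Re h); nra.
move: h xe x1 ye y2 y3 {hd hx hy mE} => [x y] /= xe x1 ye y2 y3.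
move: (d1P _ x1) (d2P _ y2) (d3P _ y3).
rewrite expR0 cos0 sin0 !subr0 oppr0 mulr0 !mulr1 subr0.
move=> E1 E2 E3.
rewrite !mul0r addr0 subr0.
have C1 : `|cos y| <= 1 by rewrite ler_norml cos_geN1 cos_le1.
have S1 : `|sin y| <= 2 * `|y|.
  have -> : sin y = (sin y - y) + y by ring.
  apply: le_trans (ler_normD _ _) _; have := normr_ge0 y; nra.
have X1 : `|expR x - 1| <= 2 * `|x|.
  have -> : expR x - 1 = (expR x - 1 - x) + x by ring.
  apply: le_trans (ler_normD _ _) _; have := normr_ge0 x; nra.
(* Each summand now contains one of the three Taylor remainders or the product (exp x - 1) sin y,
   which is small because |x| < e'. *)
have -> : expR x * cos y - 1 - x =
  (expR x - 1 - x) * cos y + (1 + x) * (cos y - 1) by ring.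
have -> : expR x * sin y - y = (expR x - 1) * sin y + (sin y - y) by ring.
have A5 := normr_ge0 x.
have A6 := normr_ge0 y.
have B1 : `|1 + x| <= 2.
  by apply: le_trans (ler_normD _ _) _; rewrite normr1; lra.
have H1 : `|(expR x - 1 - x) * cos y + (1 + x) * (cos y - 1)| <=
    e' * `|x| + 2 * (e' * `|y|).
  apply: le_trans (ler_normD _ _) _; rewrite !normrM.
  apply: lerD; last exact: ler_pM.
  by rewrite -[leRHS]mulr1; exact: ler_pM.
have H2 : `|(expR x - 1) * sin y + (sin y - y)| <=
    (2 * e') * (2 * `|y|) + e' * `|y|.
  apply: le_trans (ler_normD _ _) _; rewrite normrM; apply: lerD => //.
  apply: ler_pM => //; lra.
have P1 : 0 <= e' * `|x| by rewrite mulr_ge0 // ltW.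
have P2 : 0 <= e' * `|y| by rewrite mulr_ge0 // ltW.
lra.
Qed.


(** The functional equation [cexpD] moves the difference quotient to the origin, where
    [cexp_taylor1] gives the derivative 1. *)
Lemma derivable_cexp (R : realType) (z : R[i]^o) :
  derivable (@cexp R : R[i]^o -> R[i]^o) z 1.
Proof.
apply/derivable1P.
have -> : (fun h : R[i]^o => cexp (h *: 1 + z) : R[i]^o) =
    (fun h : R[i]^o => cexp h * cexp z : R[i]^o).
  by apply/funext => h; rewrite [_ *: 1]mulr1 cexpD.
apply: derivableM; last exact: derivable_cst.
apply/cvg_ex; exists (1 : R[i]^o); apply/cvgrPdist_le => /= e e0.
have [r r0 ->] := pos_complex_real e0.
have [d d0 dP] := cexp_taylor1 r0.
apply/nbhs_normP; exists d%:C; first by rewrite /= ltcR.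
move=> h; rewrite /= sub0r normrN addr0 [_ *: 1]mulr1 cexp0 => /dP hd h0.
have -> : 1 - h^-1 *: (cexp h - 1) = - h^-1 * (cexp h - 1 - h).
  by rewrite /GRing.scale/=; field.
by rewrite normrM normrN normfV ler_pdivrMl ?normr_gt0 // mulrC.
Qed.

(** * Algebra of 2 by 2 matrices and Pauli matrices *)

Lemma ord2P (k : 'I_2) : k = 0 \/ k = 1.
Proof. by case: k => [[|[|//]] ?]; [left|right]; exact/val_inj. Qed.

Lemma mx2P (R : realType) (A B : 'M[R[i]]_2) :
  A 0 0 = B 0 0 -> A 0 1 = B 0 1 -> A 1 0 = B 1 0 -> A 1 1 = B 1 1 -> A = B.
Proof.
move=> e00 e01 e10 e11; apply/matrixP => i j.
by have [] := ord2P i; have [] := ord2P j => -> ->.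
Qed.

Lemma mulmx2E (R : realType) (A B : 'M[R[i]]_2) i j :
  (A *m B) i j = A i 0 * B 0 j + A i 1 * B 1 j.
Proof.
rewrite mxE !big_ord_recl big_ord0 addr0.
by have -> : lift ord0 ord0 = 1 :> 'I_2 by exact/val_inj.
Qed.

Lemma mx2M (R : realType) (a b c d a' b' c' d' : R[i]) :
  mx2 a b c d *m mx2 a' b' c' d' =
  mx2 (a * a' + b * c') (a * b' + b * d') (c * a' + d * c') (c * b' + d * d').
Proof. by apply: mx2P; rewrite mulmx2E !mxE. Qed.

Lemma mx2_1 (R : realType) : mx2 1 0 0 1 = 1%:M :> 'M[R[i]]_2.
Proof. by apply: mx2P; rewrite !mxE. Qed.

Section pauli.
Variable R : realType.
Implicit Types (f g : R[i]).

Definition sigma1 : 'M[R[i]]_2 := mx2 0 1 1 0.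
Definition sigma3 : 'M[R[i]]_2 := mx2 1 0 0 (- 1).

Lemma sigma1_sq : sigma1 *m sigma1 = 1%:M.
Proof. by rewrite mx2M !(mulr0, mul0r, addr0, add0r, mulr1) mx2_1. Qed.

Lemma sigma3_sq : sigma3 *m sigma3 = 1%:M.
Proof.
by rewrite mx2M !(mulr0, mul0r, addr0, add0r, mulr1) mulrNN mulr1 mx2_1.
Qed.

Lemma exp_sigma3D f g : exp_sigma3 (f + g) = exp_sigma3 f *m exp_sigma3 g.
Proof.
by rewrite mx2M !(mulr0, mul0r, addr0, add0r) /exp_sigma3 opprD !cexpD.
Qed.

Lemma exp_sigma3_0 : exp_sigma3 (0 : R[i]) = 1%:M.
Proof. by rewrite /exp_sigma3 oppr0 cexp0 mx2_1. Qed.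

Lemma exp_sigma3_sigma1 f : exp_sigma3 f *m sigma1 = sigma1 *m exp_sigma3 (- f).
Proof. by rewrite !mx2M !(mulr0, mul0r, addr0, add0r, mulr1, mul1r, opprK). Qed.

Lemma exp_sigma3_sigma3 f : exp_sigma3 f *m sigma3 = sigma3 *m exp_sigma3 f.
Proof.
by rewrite !mx2M !(mulr0, mul0r, addr0, add0r, mulr1, mul1r, mulrN, mulNr).
Qed.

(** [sigma1] exchanges the rows and [sigma3] negates the second column; the normalizing scalar is
    symmetric in [a] and [b]. *)
Lemma Gmx_swap (a b : R[i]) : Gmx b a = - sigma1 *m Gmx a b *m sigma3.
Proof.
rewrite /Gmx -scalemxAr -scalemxAl addrC mulNmx !mx2M; congr (_ *: _).
by apply: mx2P; rewrite mulNmx mx2M !mxE /=; ring.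
Qed.

End pauli.
Arguments sigma1 {R}.
Arguments sigma3 {R}.

(** * The transformation of solutions and its algebra *)

Section transform.
Variable R : realType.
Implicit Types (X T : R) (z : R[i]) (P : R[i] -> 'M[R[i]]_2).

(** This is [phase] without its pole at 0, so exponentials of it are admissible inside the disc. *)
Definition entire_phase X T z : R[i] := z * X%:C + z ^+ 2 * T%:C.

Definition inner_factor X T z : 'M[R[i]]_2 :=
  exp_sigma3 (- (2 * 'i%C * entire_phase X T (- z))) *m - sigma1.

Definition outer_factor z : 'M[R[i]]_2 :=
  exp_sigma3 (4 * 'i%C * z^-1) *m sigma3.

(** The left [sigma3] restores the limit 1 at infinity, where [outer_factor] tends to [sigma3].
    Points of the circle fall in the second branch, and their values are immaterial. *)
Definition swap X T P z : 'M[R[i]]_2 :=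
  sigma3 *m P (- z) *m
  (if `|z| < 1 then inner_factor X T z else outer_factor z).

Lemma entire_phaseN X T z : entire_phase (- X) T (- z) = entire_phase X T z.
Proof. by rewrite /entire_phase rmorphN /=; ring. Qed.

(** Both factors equal the same matrix - exp(f sigma3) sigma1, which squares to 1 because [sigma1]
    flips the sign of the exponent. *)
Lemma inner_factor_inv X T z :
  inner_factor X T (- z) *m inner_factor (- X) T z = 1%:M.
Proof.
rewrite /inner_factor opprK entire_phaseN; set f := - _.
rewrite !mulmxN mulNmx opprK {2}exp_sigma3_sigma1 -mulmxA (mulmxA sigma1).
by rewrite sigma1_sq mul1mx -exp_sigma3D subrr exp_sigma3_0.
Qed.

(** The exponent is odd in [z] and [sigma3] commutes with the exponential. *)
Lemma outer_factor_inv z : outer_factor (- z) *m outer_factor z = 1%:M.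
Proof.
rewrite /outer_factor exp_sigma3_sigma3 -mulmxA (mulmxA _ _ sigma3).
rewrite -exp_sigma3D invrN mulrN addNr exp_sigma3_0 mul1mx.
exact: sigma3_sq.
Qed.

(** This carries the jump relation of [P] at [- z] to that of [swap X T P] at [z]. *)
Lemma jump_swap X T a b z :
  inner_factor X T z *m jump (- X) T (Gmx b a) z =
  jump X T (Gmx a b) (- z) *m outer_factor z.
Proof.
rewrite /inner_factor /jump /outer_factor Gmx_swap.
set f := - (2 * _ * _); set g := 'i%C * phase (- X) T z.
set h := 'i%C * phase X T (- z); set k := 4 * _ * _.
(* The phases behind [g] and [h] have the same polynomial part and opposite poles: they differ by
   4/z, while removing twice the polynomial part from [g] leaves [- h]. *)
have gE : g = h + k by rewrite /g /h /k /phase rmorphN /= invrN; ring.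
have fgE : f + g = - h.
  by rewrite /f /g /h /phase /entire_phase rmorphN /= invrN; ring.
rewrite !(mulmxN, mulNmx) opprK !mulmxA.
rewrite -(mulmxA _ (exp_sigma3 (- g)) sigma1) exp_sigma3_sigma1 opprK !mulmxA.
rewrite -(mulmxA _ sigma1 sigma1) sigma1_sq mulmx1 -exp_sigma3D fgE.
by rewrite -(mulmxA _ sigma3) -exp_sigma3_sigma3 gE exp_sigma3D !mulmxA.
Qed.

(** Since [z] and [- z] have the same modulus, both applications use the same branch, and the
    factors cancel in pairs. *)
Lemma swapK X T P z : ~ circle (z : R[i]^o) ->
  swap (- X) T (swap X T P) z = P z.
Proof.
move=> zc; rewrite /swap normrN opprK !mulmxA sigma3_sq mul1mx.
case: ifP => _; rewrite -mulmxA; last by rewrite outer_factor_inv mulmx1.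
by rewrite inner_factor_inv mulmx1.
Qed.

End transform.

(** * Entrywise limits and derivatives of matrix functions *)

Section mx_limits.
Variable R : realType.

(** The entrywise form makes the limits required in [RHP_solution] instances by mere unfolding. *)
Definition mx_cvg (U : Type) (m n : nat) (F : set_system U)
    (P : U -> 'M[R[i]]_(m, n)) (A : 'M[R[i]]_(m, n)) :=
  forall i j, (fun w => P w i j : R[i]^o) @ F --> (A i j : R[i]^o).

Lemma mx_cvg_cst U m n (F : set_system U) {FF : Filter F}
    (A : 'M[R[i]]_(m, n)) :
  mx_cvg F (fun=> A) A.
Proof. by move=> i j; exact: cvg_cst. Qed.

Lemma mx_cvgM U m n p (F : set_system U) {FF : Filter F}
    (P : U -> 'M[R[i]]_(m, n)) (Q : U -> 'M[R[i]]_(n, p)) A B :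
  mx_cvg F P A -> mx_cvg F Q B -> mx_cvg F (fun w => P w *m Q w) (A *m B).
Proof.
move=> PA QB i j; rewrite mxE.
under eq_fun do rewrite mxE.
apply: cvg_big => [|k _]; [exact: add_continuous|exact: cvgM].
Qed.

Definition mx_derivable m n (P : R[i] -> 'M[R[i]]_(m, n)) (z : R[i]^o) :=
  forall i j, derivable (fun w : R[i]^o => P w i j : R[i]^o) z 1.

Lemma mx_derivableM m n p (P : R[i] -> 'M[R[i]]_(m, n))
    (Q : R[i] -> 'M[R[i]]_(n, p)) z :
  mx_derivable P z -> mx_derivable Q z -> mx_derivable (fun w => P w *m Q w) z.
Proof.
move=> dP dQ i j.
have -> : (fun w => (P w *m Q w) i j : R[i]^o) =
    \sum_k ((fun w => P w i k) * (fun w => Q w k j)) :> (R[i]^o -> R[i]^o).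
  by apply/funext => w; rewrite mxE fct_sumE.
by apply: derivable_sum => k; exact: derivableM.
Qed.

Lemma mx_derivable_cst m n (A : 'M[R[i]]_(m, n)) z : mx_derivable (fun=> A) z.
Proof. by move=> i j; exact: derivable_cst. Qed.

Lemma mx_derivableN m n (P : R[i] -> 'M[R[i]]_(m, n)) (z : R[i]^o) :
  mx_derivable P (- z) -> mx_derivable (fun w => P (- w)) z.
Proof.
move=> dP i j; apply/derivable1_diffP.
apply: (@differentiable_comp _ _ _ _ (-%R : R[i]^o -> R[i]^o)
  (fun w : R[i]^o => P w i j : R[i]^o)); first exact: differentiableN.
exact/derivable1_diffP/dP.
Qed.

Lemma mx_derivable_exp_sigma3 (f : R[i] -> R[i]) (z : R[i]^o) :
  derivable (f : R[i]^o -> R[i]^o) z 1 ->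
  mx_derivable (fun w => exp_sigma3 (f w)) z.
Proof.
move=> df.
have dexp (g : R[i]^o -> R[i]^o) : derivable g z 1 ->
    derivable (fun w : R[i]^o => cexp (g w) : R[i]^o) z 1.
  move=> dg; apply/derivable1_diffP/differentiable_comp.
    exact/derivable1_diffP.
  exact/derivable1_diffP/derivable_cexp.
move=> i j; under eq_fun do rewrite mxE.
case: ifP => _; case: ifP => _; [exact: dexp|exact: derivable_cst..|].
by apply: dexp; exact: derivableN.
Qed.

Lemma mx_derivable_cvg m n (P : R[i] -> 'M[R[i]]_(m, n)) (z : R[i]^o) :
  mx_derivable P z -> mx_cvg (nbhs z) P (P z).
Proof.
by move=> dP i j; apply/differentiable_continuous/derivable1_diffP/dP.
Qed.

Lemma derivable_entire_phase X T (z : R[i]^o) :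
  derivable (entire_phase X T : R[i]^o -> R[i]^o) z 1.
Proof.
have dM (c : R[i]^o) (f : R[i]^o -> R[i]^o) : derivable f z 1 ->
    derivable (fun w => f w * c : R[i]^o) z 1.
  by move=> df; apply: derivableM; [exact: df|exact: derivable_cst].
have d1 : derivable (fun w : R[i]^o => w * X%:C : R[i]^o) z 1.
  by apply: dM; exact: derivable_id.
have d2 : derivable (fun w : R[i]^o => w ^+ 2 * T%:C : R[i]^o) z 1.
  by apply: (dM _ (fun w => w * w)); apply: derivableM; exact: derivable_id.
exact: derivableD d1 d2.
Qed.

Lemma derivable_inner_factor X T z : mx_derivable (inner_factor X T) z.
Proof.
apply: mx_derivableM; last exact: mx_derivable_cst.
apply: mx_derivable_exp_sigma3; apply: derivableN; apply: derivableM.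
  exact: derivable_cst.
(* The reflection of the argument is traded for a change of sign of [X]. *)
have -> : (fun w => entire_phase X T (- w)) =
    entire_phase (- X) T :> (R[i]^o -> R[i]^o).
  by apply/funext => w; rewrite -entire_phaseN opprK.
exact: derivable_entire_phase.
Qed.

Lemma derivable_outer_factor z : z != 0 -> mx_derivable (@outer_factor R) z.
Proof.
move=> z0; apply: mx_derivableM; last exact: mx_derivable_cst.
apply: mx_derivable_exp_sigma3; apply: derivableM; first exact: derivable_cst.
by apply: derivableV => //; exact: derivable_id.
Qed.

End mx_limits.

(** [lim] is chosen from the set of limits, so equal sets give equal values, even when they are
    empty and a default is returned. *)
Lemma lim_eq (U : pnbhsType) (F G : set_system U) :
  (forall l : U, F --> l <-> G --> l) -> lim F = lim G.
Proof.
move=> FG; rewrite /lim /lim_in; congr (xget _ _).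
by apply/funext => l; exact/propext/FG.
Qed.

(** * The filter at infinity and neighbourhoods off the unit circle *)

Section filters.
Variable R : realType.

Global Instance cinfty_filter : Filter (@cinfty R).
Proof.
split; first by exists 0.
  move=> A B [M AM] [N BN]; exists (Num.max M N) => z zMN.
  by split; [apply: AM|apply: BN]; apply: le_lt_trans zMN;
     rewrite lecR le_max lexx ?orbT.
by move=> A B AB [M AM]; exists M => z /AM /AB.
Qed.

Lemma cinfty_gt (M : R) : \forall z \near @cinfty R, M%:C < `|z|.
Proof. by exists M. Qed.

Lemma cvg_opp_cinfty : (fun z : R[i]^o => - z) @ @cinfty R --> @cinfty R.
Proof. by move=> A [M AM]; exists M => z zM; apply: AM; rewrite normrN. Qed.

Lemma cvg_inv_cinfty :
  (fun z : R[i]^o => z^-1 : R[i]^o) @ @cinfty R --> (0 : R[i]^o).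
Proof.
apply/cvgrPdist_lt => /= e e0.
have [r r0 ->] := pos_complex_real e0.
exists r^-1 => z zr; rewrite sub0r normrN normfV.
have z0 : 0 < `|z| by apply: le_lt_trans zr; rewrite lecR invr_ge0 ltW.
by rewrite invf_plt ?posrE ?[_ < r%:C]ltcR //; move: zr; rewrite fmorphV.
Qed.

Lemma cvg_opp_within (D : set R[i]^o) (z : R[i]^o) :
  (forall w, D w -> D (- w)) ->
  (fun w : R[i]^o => - w) @ within D (nbhs z) --> within D (nbhs (- z)).
Proof.
have oppz : (fun w : R[i]^o => - w : R[i]^o) @ nbhs z --> (- z : R[i]^o).
  by apply: cvgN; exact: cvg_id.
move=> DN A AN; change (nbhs z (fun w : R[i]^o => D w -> A (- w))).
have AN' : nbhs z (fun w : R[i]^o => D (- w) -> A (- w)) := oppz _ AN.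
by apply: filterS AN' => w DA /DN /DA.
Qed.

(** Near a point inside the disc, [swap] thus has a single branch; [near_norm_gt1] serves the
    exterior. *)
Lemma near_norm_lt1 (z : R[i]^o) : `|z| < 1 -> \forall w \near z, `|w| < 1.
Proof.
move=> z1; apply/nbhs_normP; exists (1 - `|z|); first by rewrite /= subr_gt0.
move=> w /= zw; have -> : w = z - (z - w) by rewrite opprB addrC subrK.
by apply: le_lt_trans (ler_normB _ _) _; rewrite -ltrBrDl.
Qed.

Lemma near_norm_gt1 (z : R[i]^o) : 1 < `|z| -> \forall w \near z, 1 < `|w|.
Proof.
move=> z1; apply/nbhs_normP; exists (`|z| - 1); first by rewrite /= subr_gt0.
move=> w /= zw; rewrite ltrBrDr -ltrBrDl in zw.
by apply: lt_le_trans zw _; rewrite lerBlDr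
  -[in leLHS](subrK w z) addrC ler_normD.
Qed.

(** The order on [R[i]] is partial, but norms are real and hence comparable with 1. *)
Lemma circle_split (z : R[i]^o) : ~ circle z -> `|z| < 1 \/ 1 < `|z|.
Proof.
move=> zc; have [|] := real_ltP (normr_real z) (@real1 R[i]); first by left.
by rewrite le_eqVlt => /predU1P[/esym //|]; right.
Qed.

Lemma circleN (z : R[i]^o) : circle z -> circle (- z).
Proof. by rewrite /circle /= normrN. Qed.

Lemma circle_neq0 (z : R[i]^o) : circle z -> z != 0.
Proof. by rewrite /circle /= -normr_gt0 => ->. Qed.

End filters.

(** * Symmetry of the Riemann-Hilbert problem *)

Section symmetry.
Variable R : realType.
Implicit Types (X T : R).

Lemma mx_cvg_near (U : Type) m n (F : set_system U) {FF : Filter F}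
    (P Q : U -> 'M[R[i]]_(m, n)) A :
  {near F, P =1 Q} -> mx_cvg F P A -> mx_cvg F Q A.
Proof.
move=> PQ PA i j; apply: cvg_trans (PA i j); apply: near_eq_cvg.
by apply: filterS PQ => w ->.
Qed.

Lemma mx_derivable_near m n (P Q : R[i] -> 'M[R[i]]_(m, n)) (z : R[i]^o) :
  {near z, P =1 Q} -> mx_derivable P z -> mx_derivable Q z.
Proof.
move=> PQ dP i j; apply: near_eq_derivable (dP i j).
by apply: filterS PQ => w ->.
Qed.

Lemma mx_cvg_comp (U V : Type) m n (F : set_system U) (G : set_system V)
    (f : U -> V) (P : V -> 'M[R[i]]_(m, n)) A :
  f @ F --> G -> mx_cvg G P A -> mx_cvg F (P \o f) A.
Proof. by move=> fG PA i j; exact: cvg_comp fG (PA i j). Qed.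

(** This treats both sides of the circle at once: [E] stands for [outer_factor] or [inner_factor].
    Reflection preserves [D] and the circle, and limits of products do the rest. *)
Lemma boundary_value_swap (D : set R[i]^o) (P Q Pb E : R[i] -> 'M[R[i]]_2) :
  (forall w, D w -> D (- w)) ->
  (forall z : R[i]^o, circle z -> mx_cvg (nbhs z) E (E z)) ->
  (forall z, D z -> Q z = sigma3 *m P (- z) *m E z) ->
  has_boundary_value D P Pb ->
  has_boundary_value D Q (fun z => sigma3 *m Pb (- z) *m E z).
Proof.
move=> DN Ec QE bP.
have P_cvg z : circle z -> mx_cvg (within D (nbhs z)) P (Pb z).
  by move=> zc i j; have [/(_ z zc)] := bP i j.
have Pb_cvg z : circle z -> mx_cvg (within (@circle R) (nbhs z)) Pb (Pb z).
  by move=> zc i j; have [_ /subspace_continuousP/(_ z zc)] := bP i j.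
have Ecw (B : set R[i]^o) z : circle z -> mx_cvg (within B (nbhs z)) E (E z).
  by move=> zc i j; apply: cvg_within_filter; exact: Ec.
move=> i j; split.
  move=> z zc; move: i j; apply: (@mx_cvg_near _ _ _ _ _
    (fun w => sigma3 *m P (- w) *m E w)).
    by rewrite near_withinE; near=> w => Dw; rewrite QE.
  apply: mx_cvgM; last exact: Ecw.
  apply: mx_cvgM; first exact: mx_cvg_cst.
  by apply: mx_cvg_comp (P_cvg _ (circleN zc)); exact: cvg_opp_within.
apply/subspace_continuousP => z zc; move: i j.
apply: mx_cvgM; last exact: Ecw.
apply: mx_cvgM; first exact: mx_cvg_cst.
apply: mx_cvg_comp (Pb_cvg _ (circleN zc)); apply: cvg_opp_within.
exact: circleN.
Unshelve. all: by end_near. Qed.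

Lemma outer_factor_cvg : mx_cvg (@cinfty R) (@outer_factor R) sigma3.
Proof.
rewrite -[X in mx_cvg _ _ X]mul1mx -(exp_sigma3_0 R).
apply: mx_cvgM; last exact: mx_cvg_cst.
(* The limit is written as the value at w = 0 of a continuous function, into which w = 1/z is
   substituted. *)
rewrite -(mulr0 (4 * 'i%C : R[i])).
have H : mx_cvg (nbhs (0 : R[i]^o)) (fun w => exp_sigma3 (4 * 'i%C * w))
    (exp_sigma3 (4 * 'i%C * 0)).
  apply: mx_derivable_cvg; apply: mx_derivable_exp_sigma3.
  by apply: derivableM; [exact: derivable_cst|exact: derivable_id].
exact: mx_cvg_comp (@cvg_inv_cinfty R) H.
Qed.

Lemma swap_outer X T (P : R[i] -> 'M[R[i]]_2) (z : R[i]) : 1 < `|z| ->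
  swap X T P z = sigma3 *m P (- z) *m outer_factor z.
Proof. by rewrite /swap => z1; rewrite (lt_gtF z1). Qed.

Lemma swap_inner X T (P : R[i] -> 'M[R[i]]_2) (z : R[i]) : `|z| < 1 ->
  swap X T P z = sigma3 *m P (- z) *m inner_factor X T z.
Proof. by rewrite /swap => ->. Qed.

Lemma RHP_solution_swap X T a b (P : R[i] -> 'M[R[i]]_2) :
  RHP_solution X T (Gmx a b) P -> RHP_solution (- X) T (Gmx b a) (swap X T P).
Proof.
move=> [anP [Pp [Pm [bPp bPm jmp]]] Pinf]; split.
- suff dQ z : ~ circle z -> mx_derivable (swap X T P) z by move=> i j z /dQ.
  move=> zc.
  have dP : mx_derivable (fun w => sigma3 *m P (- w)) z.
    apply: mx_derivableM; first exact: mx_derivable_cst.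
    apply: mx_derivableN => i j; apply: anP.
    by move=> /circleN; rewrite opprK.
  have [z1|z1] := circle_split zc.
    apply: (@mx_derivable_near _ _
      (fun w => sigma3 *m P (- w) *m inner_factor X T w)).
      by apply: filterS (near_norm_lt1 z1) => w w1; rewrite swap_inner.
    by apply: mx_derivableM dP _; exact: derivable_inner_factor.
  apply: (@mx_derivable_near _ _
    (fun w => sigma3 *m P (- w) *m outer_factor w)).
    by apply: filterS (near_norm_gt1 z1) => w w1; rewrite swap_outer.
  apply: mx_derivableM dP _; apply: derivable_outer_factor.
  by rewrite -normr_gt0 (lt_trans ltr01).
- exists (fun z => sigma3 *m Pp (- z) *m outer_factor z).
  exists (fun z => sigma3 *m Pm (- z) *m inner_factor X T z); split.
  + apply: boundary_value_swap bPp.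
    * by move=> w; rewrite /exterior_disc /= normrN.
    * move=> z zc; apply: mx_derivable_cvg; apply: derivable_outer_factor.
      exact: circle_neq0.
    * by move=> z zc; rewrite swap_outer.
  + apply: boundary_value_swap bPm.
    * by move=> w; rewrite /interior_disc /= normrN.
    * by move=> z zc; apply: mx_derivable_cvg; exact: derivable_inner_factor.
    * by move=> z zc; rewrite swap_inner.
  (* The jump relation of [P] is used at the reflected point [- z]. *)
  + move=> z zc; rewrite -(mulmxA _ (inner_factor X T z)) jump_swap.
    by rewrite (jmp _ (circleN zc)) !mulmxA.
(* The identity is written as sigma3 1 sigma3, the product of the limits of the three factors of
   [swap]. *)
- rewrite -(@sigma3_sq R) -[X in X *m _]mulmx1.
  apply: (@mx_cvg_near _ _ _ _ _
    (fun w => sigma3 *m P (- w) *m outer_factor w)).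
    apply: filterS (cinfty_gt 1) => w w1; rewrite swap_outer //.
  apply: mx_cvgM; last exact: outer_factor_cvg.
  apply: mx_cvgM; first exact: mx_cvg_cst.
  by apply: mx_cvg_comp (Pinf : mx_cvg _ _ _); exact: cvg_opp_cinfty.
Qed.

(** A competitor [Q] is swapped back to the original problem, identified there with [P], and
    recovered by [swapK]. *)
Lemma RHP_unique_solution_swap X T a b (P : R[i] -> 'M[R[i]]_2) :
  RHP_unique_solution X T (Gmx a b) P ->
  RHP_unique_solution (- X) T (Gmx b a) (swap X T P).
Proof.
move=> [solP uniqP]; split; first exact: RHP_solution_swap.
move=> Q /RHP_solution_swap; rewrite opprK => /uniqP QP z zc.
rewrite -(swapK (- X) T Q zc) opprK /swap -/(swap (- X) T Q (- z)) QP //.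
by move=> /circleN; rewrite opprK.
Qed.

(** As [outer_factor] is diagonal, the entry [0 1] of [Q] at [z] is that of [P] at [- z] times
    [outer_factor z 1 1]. *)
Lemma cvg_entry12_swap X T a b (P Q : R[i] -> 'M[R[i]]_2) (l : R[i]^o) :
  RHP_unique_solution X T (Gmx a b) P ->
  RHP_solution (- X) T (Gmx b a) Q ->
  (fun z : R[i]^o => z * P z 0 1 : R[i]^o) @ @cinfty R --> l ->
  (fun z : R[i]^o => z * Q z 0 1 : R[i]^o) @ @cinfty R --> l.
Proof.
move=> /RHP_unique_solution_swap[_ uniqQ] /uniqQ QE Pl.
(* The two minus signs cancel: the first factor is the given function at [- z], and the second tends
   to 1. *)
pose f (z : R[i]^o) : R[i]^o := (- z * P (- z) 0 1) * - outer_factor z 1 1.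
have fE : {near @cinfty R, f =1 (fun z => z * Q z 0 1)}.
  apply: filterS (cinfty_gt 1) => w w1; rewrite /f QE; last first.
    by move=> wc; move: w1; rewrite wc ltxx.
  have out01 : outer_factor w 0 1 = 0 by rewrite mulmx2E !mxE /=; ring.
  rewrite swap_outer // [(_ *m outer_factor w) 0 1]mulmx2E out01.
  rewrite [(sigma3 *m _) 0 1]mulmx2E.
  by move: (outer_factor w 1 1) => o; rewrite !mxE /=; ring.
apply: cvg_trans (near_eq_cvg fE) _.
rewrite -[l]mulr1; apply: cvgM.
  exact: cvg_comp (@cvg_opp_cinfty R) Pl.
have -> : 1 = - (@sigma3 R 1 1) :> R[i]^o by rewrite !mxE /= opprK.
by apply: cvgN; exact: outer_factor_cvg.
Qed.

Lemma Pmx_unique X T G (P : R[i] -> 'M[R[i]]_2) :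
  RHP_unique_solution X T G P -> RHP_unique_solution X T G (Pmx X T G).
Proof. by move=> uP; exact: (xgetI _ uP). Qed.

End symmetry.

Theorem proposition1p3 (R : realType) (a b : R[i]) (X T : R)
  (hab : (a, b) <> (0, 0)) :
  Psi X T (Gmx a b) = Psi (- X) T (Gmx b a).
Proof.
rewrite /Psi; apply: (congr1 (fun l => 2 * 'i%C * l)).
(* Either [Pmx] is the genuine solution on both sides, or it is the default on both. *)
have [[P uP]|noP] := pselect (exists P, RHP_unique_solution X T (Gmx a b) P).
  have uPab := Pmx_unique uP.
  have uPba := Pmx_unique (RHP_unique_solution_swap uP).
  apply: (@lim_eq R[i]^o) => l; split.
    exact: cvg_entry12_swap uPab uPba.1.
  (* The converse is the same implication for the swapped data, since the symmetry is an
     involution. *)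
  have := @cvg_entry12_swap R (- X) T b a _ _ l uPba.
  by rewrite opprK; apply; exact: uPab.1.
(* A solution of the swapped problem would swap back, so both [Pmx] are the constant [1%:M] and the
   limits coincide. *)
have noQ Q : ~ RHP_unique_solution (- X) T (Gmx b a) Q.
  by move=> /RHP_unique_solution_swap; rewrite opprK => uP; apply: noP;
     eexists; exact: uP.
rewrite /Pmx xgetPN; last by move=> P uP; apply: noP; exists P.
by rewrite xgetPN.
Qed.
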